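(* Let $\mathcal{A}_F$ be the set of all binary Fibonacci-automatic infinite sequences. Then $\mathrm{rt}(\mathcal{A}_F)=7/3$.
   Context: In the Zeckendorf (Fibonacci) numeration system, with Fibonacci numbers $F_0=0,F_1=1,F_{i}=F_{i-1}+F_{i-2}$, each natural number $n$ is written uniquely as a sum of Fibonacci numbers $F_i$ with $i\ge2$ never using both $F_i$ and $F_{i+1}$; this gives a binary word representation. A sequence $(a_n)_{n\ge0}$ is Fibonacci-automatic if a deterministic finite automaton with output, on input the Zeckendorf representation of $n$ (most significant digit first), outputs $a_n$. For a finite word $w=w[1..n]$, $p$ ($1\le p\le n$) is a period if $w[i]=w[i+p]$ for $1\le i\le n-p$; $\exp(w)=n/p$ for the smallest period $p$. The critical exponent $\mathrm{ce}(\mathbf{x})$ of an infinite word is the supremum of $\exp(w)$ over finite nonempty factors $w$; for a nonempty set $S$ of infinite words, $\mathrm{rt}(S)=\inf_{\mathbf{x}\in S}\mathrm{ce}(\mathbf{x})$. *)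

(* Defs.v *)
From mathcomp Require Import all_boot all_order all_algebra.
From mathcomp Require Import boolp classical_sets reals constructive_ereal ereal.

Set Implicit Arguments.
Unset Strict Implicit.
Unset Printing Implicit Defensive.

Import Order.TTheory GRing.Theory Num.Theory.

Local Open Scope classical_set_scope.

Fixpoint fib (n : nat) : nat :=
  match n with
  | 0 => 0
  | 1 => 1
  | (m.+1 as k).+1 => fib k + fib m
  end.

(* Words are written most significant digit first, so the digit at position i
   of w is the coefficient of F_(size w + 1 - i); the last one goes with F_2. *)
Definition fib_value (w : seq bool) : nat :=
  \sum_(i < size w) nth false w i * fib (size w + 1 - i).

(* Without leading zero; in particular 0 is represented by the empty word. *)
Definition zeckendorf (n : nat) (w : seq bool) : bool :=
  [&& head true w, sorted (fun a b => ~~ (a && b)) w & fib_value w == n].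

Record dfao (A B : Type) := Dfao {
  dfao_state : finType;
  dfao_init : dfao_state;
  dfao_step : dfao_state -> A -> dfao_state;
  dfao_out : dfao_state -> B
}.

Definition dfao_run (A B : Type) (M : dfao A B) (w : seq A) : B :=
  dfao_out (foldl (@dfao_step A B M) (dfao_init M) w).

Definition fib_automatic (B : Type) (x : nat -> B) : Prop :=
  exists M : dfao bool B,
    forall (n : nat) (w : seq bool), zeckendorf n w -> dfao_run M w = x n.

Definition binary_fib_automatic : set (nat -> bool) :=
  [set x | fib_automatic x].

Definition is_period (T : eqType) (w : seq T) (p : nat) : bool :=
  (1 <= p <= size w) &&
  [forall i : 'I_(size w - p), onth w i == onth w (i + p)].

(* [find] on 0, 1, 2, ... returns the least p satisfying the predicate; when w is
   nonempty one exists, since size w is a period of w. *)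
Definition min_period (T : eqType) (w : seq T) : nat :=
  find (is_period w) (iota 0 (size w).+1).

Definition factor (T : Type) (x : nat -> T) (w : seq T) : Prop :=
  exists i : nat, w = mkseq (fun j => x (i + j)) (size w).

Local Open Scope ring_scope.

Definition word_exp (R : realType) (T : eqType) (w : seq T) : R :=
  (size w)%:R / (min_period w)%:R.

Definition critical_exponent (R : realType) (T : eqType) (x : nat -> T) : \bar R :=
  ereal_sup [set (word_exp R w)%:E | w in [set w | factor x w /\ w <> [::]]].

Definition repetition_threshold (R : realType) (T : eqType)
    (S : set (nat -> T)) : \bar R :=
  ereal_inf [set critical_exponent R x | x in S].

(* Main.v *)
From HB Require Import structures.
Require Import Defs.
From mathcomp Require Import all_boot all_order all_algebra.
From mathcomp Require Import zify.
From mathcomp Require Import boolp classical_sets reals constructive_ereal ereal.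

(* Lower bound: if all exponents in x are below 7/3 then x = u mu(y) with
   0 < |u| <= 2, mu the Thue-Morse morphism and y again of this kind; hence two
   equal factors of length about 2^k occur at a distance divisible by 2^k. If x
   is Fibonacci-automatic, two prefixes 10^a and 10^b lead to the same state, so
   long equal factors occur at the distances D_n = F_(b+n) - F_(a+n). As D_n
   satisfies the Fibonacci recurrence, high powers of 2 dividing D_n and D_(n+1)
   also divide D_0, which is absurd.

   Upper bound: the morphism phi below has a square-free fixed point theta over
   five letters whose block lengths |phi^k(a)| are Fibonacci numbers. The morphism
   gamma has |gamma(a)| = |phi^5(a)|, so the digit of gamma(theta) at n is a function
   of the letter reached by all Zeckendorf digits of n but the last five, and of
   these five. Both phi^2 and gamma are recognizable through short windows, so a long
   repetition in gamma(theta) of exponent above 7/3 gives a square in theta, a long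
   near-square in theta gives a shorter one, and short repetitions are excluded by
   computation on finitely many factors. *)

Set Implicit Arguments.
Unset Strict Implicit.
Unset Printing Implicit Defensive.

(** * Words, morphisms and recognizability *)

Definition repetition (T : Type) (x : nat -> T) (i p l : nat) : Prop :=
  forall t, t < l -> x (i + t) = x (i + p + t).

Definition window (T : Type) (x : nat -> T) (i n : nat) : seq T :=
  mkseq (fun j => x (i + j)) n.

Lemma nth_window (T : Type) (a0 : T) (x : nat -> T) i n t :
  t < n -> nth a0 (window x i n) t = x (i + t).
Proof. exact: nth_mkseq. Qed.

Lemma window_cat (T : Type) (x : nat -> T) i m n :
  window x i (m + n) = window x i m ++ window x (i + m) n.
Proof.
rewrite /window /mkseq iotaD map_cat add0n; congr (_ ++ _).
rewrite -[m in iota m n]addn0 iotaDl -map_comp; apply: eq_map => j /=.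
by rewrite addnA.
Qed.

Lemma take_drop_window (T : Type) (x : nat -> T) i N r n :
  r + n <= N -> take n (drop r (window x i N)) = window x (i + r) n.
Proof.
move=> le; rewrite -(subnKC le) -addnA !window_cat.
by rewrite drop_size_cat ?size_mkseq // take_size_cat ?size_mkseq.
Qed.

Lemma eq_window (T : Type) (x : nat -> T) i j n :
  (forall t, t < n -> x (i + t) = x (j + t)) -> window x i n = window x j n.
Proof. by move=> eq; apply/eq_in_map => t; rewrite mem_iota => /eq. Qed.

Section Morphisms.
Variables A B : Type.

Definition subst (f : A -> seq B) (s : seq A) : seq B := flatten (map f s).

Lemma subst_cat f s1 s2 : subst f (s1 ++ s2) = subst f s1 ++ subst f s2.
Proof. by rewrite /subst map_cat flatten_cat. Qed.

Lemma leq_size_subst f m s :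
  (forall a, m <= size (f a)) -> m * size s <= size (subst f s).
Proof.
move=> fm; elim: s => [|a s IH] /=; first by rewrite muln0.
by rewrite mulnS size_cat leq_add.
Qed.

(** Encodes that the infinite word [x] is the image of [h] under [f], by means of finite prefixes
    only. *)
Definition image_word (f : A -> seq B) (h : nat -> A) (x : nat -> B) : Prop :=
  forall n, window x 0 (size (subst f (window h 0 n))) = subst f (window h 0 n).

Definition block_pos (f : A -> seq B) (h : nat -> A) (n : nat) : nat :=
  size (subst f (window h 0 n)).

Lemma block_posD f h n k :
  block_pos f h (n + k) = block_pos f h n + size (subst f (window h n k)).
Proof. by rewrite /block_pos window_cat subst_cat size_cat. Qed.

Lemma block_posS f h n :
  block_pos f h n.+1 = block_pos f h n + size (f (h n)).
Proof. by rewrite -addn1 block_posD /subst /= addn0 cats0. Qed.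

Variables (f : A -> seq B) (h : nat -> A) (x : nat -> B).
Variables (m M : nat).
Hypotheses (m_gt0 : 0 < m) (size_ge : forall a, m <= size (f a)).
Hypothesis (size_le : forall a, size (f a) <= M).
Hypothesis (imx : image_word f h x).

Local Notation pos := (block_pos f h).

Lemma window_block n k :
  window x (pos n) (size (subst f (window h n k))) = subst f (window h n k).
Proof.
have := imx (n + k); rewrite window_cat subst_cat size_cat window_cat imx.
by move/(congr1 (drop (pos n))); rewrite !drop_size_cat.
Qed.

Lemma window_letter n : window x (pos n) (size (f (h n))) = f (h n).
Proof.
by have := window_block n 1; rewrite /window /subst /= addn0 cats0.
Qed.

Lemma block_pos_ge n k : pos n + m * k <= pos (n + k).
Proof.
by rewrite block_posD leq_add2l -{1}(size_mkseq (fun j => h (n + j)) k) leq_size_subst.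
Qed.

Lemma block_pos_le n k : pos (n + k) <= pos n + M * k.
Proof.
elim: k => [|k IH]; first by rewrite muln0 !addn0.
by rewrite addnS block_posS mulnS [M + _]addnC addnA leq_add.
Qed.

Lemma block_pos_inj : injective pos.
Proof.
move=> a b; wlog le : a b / a <= b.
  by move=> W; case/orP: (leq_total a b) => le eq; [exact: W|exact/esym/W].
move=> eq; have := block_pos_ge a (b - a); rewrite subnKC //.
by have := leq_pmull (b - a) m_gt0; lia.
Qed.

Lemma locate i : exists n r, i = pos n + r /\ r < size (f (h n)).
Proof.
elim: i => [|i [n [r [-> lt]]]].
  by exists 0, 0; split=> //; apply: leq_trans (size_ge _).
have [lt'|le] := ltnP r.+1 (size (f (h n))).
  by exists n, r.+1; rewrite addnS.
exists n.+1, 0; split; last exact: leq_trans (size_ge _).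
by rewrite block_posS addn0 -addnS; congr addn; lia.
Qed.

(** From [i] on, at least one letter of the block containing [i] remains, and each of the next [k]
    blocks supplies at least [m] letters. *)
Lemma window_infix N i k : N <= m * k + 1 ->
  exists n r, [/\ i = pos n + r, r < size (f (h n)) &
    window x i N = take N (drop r (subst f (window h n k.+1)))].
Proof.
move=> Nle; have [n [r [iE lt]]] := locate i.
exists n, r; split=> //; rewrite -window_block take_drop_window ?iE //.
rewrite -add1n window_cat subst_cat size_cat {1}/subst /= cats0 addn0.
have := leq_size_subst (window h (n + 1) k) size_ge; rewrite size_mkseq.
by lia.
Qed.

(* Recognizability with windows of length W: the letter whose block starts at a
   position, and the fact that a block starts there, can be read off the next
   W letters. *)
Definition recognizable (W : nat) : Prop :=
  forall n j, window x (pos n) W = window x j W ->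
  exists2 k, j = pos k & h k = h n.

(* Only the blocks cut by the two ends of a repetition, or too close to its right
   end to be recognized, are lost. *)
Lemma repetition_desubst W i p l :
  recognizable W -> 0 < p -> W + M <= l + 1 -> repetition x i p l ->
  exists n q k, [/\ 0 < q, pos (n + q) = pos n + p,
    repetition h n q k, pos n < i + M & i + l < pos (n + k) + W].
Proof.
move=> rec p_gt0 Wl rep.
have [n0 [r [iE ltr]]] := locate i.
(* Block [n] is the first one that starts at or after [i]. *)
pose n := if r is 0 then n0 else n0.+1.
have [ni nM] : i <= pos n /\ pos n < i + M.
  have sM := size_le (h n0).
  by rewrite {}/n iE; case: r ltr iE => [|r] ltr _; rewrite ?block_posS; lia.
have sync s : pos (n + s) + W <= i + l ->
    exists2 k, pos (n + s) + p = pos k & h k = h (n + s).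
  move=> le; apply: rec; apply: eq_window => t lt_t.
  have le' := block_pos_ge n s.
  have := rep (pos (n + s) - i + t).
  have -> : i + (pos (n + s) - i + t) = pos (n + s) + t by lia.
  have -> : i + p + (pos (n + s) - i + t) = pos (n + s) + p + t by lia.
  by apply; lia.
have [k0 q0 _] : exists2 k, pos (n + 0) + p = pos k & h k = h (n + 0).
  by apply: sync; rewrite addn0; lia.
rewrite addn0 in q0.
have lt_n : n < k0.
  rewrite ltnNge; apply/negP => le.
  by have := block_pos_ge k0 (n - k0); rewrite subnKC //; lia.
have [q q_gt0 k0E] : exists2 q, 0 < q & k0 = n + q.
  by exists (k0 - n); rewrite ?subn_gt0 // subnKC // ltnW.
subst k0.
(* Equal letters have blocks of equal length, so two runs of blocks once aligned at distance [p]
   stay aligned. *)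
have main s : pos (n + s) + W <= i + l ->
    pos (n + q + s) = pos (n + s) + p /\ h (n + s) = h (n + q + s).
  elim: s => [|s IH] le.
    have [k kE hk] := sync 0 le.
    rewrite !addn0 in kE hk *; split=> //.
    by rewrite -hk; congr h; apply: block_pos_inj; rewrite -kE.
  have lts : pos (n + s) <= pos (n + s.+1) by rewrite addnS block_posS leq_addr.
  have [eqp eqh] := IH (leq_trans (leq_add lts (leqnn W)) le).
  have eqp' : pos (n + q + s.+1) = pos (n + s.+1) + p.
    by rewrite !addnS !block_posS eqp -eqh addnAC.
  split=> //; have [k kE <-] := sync _ le.
  by congr h; apply: block_pos_inj; rewrite -kE.
have ex : exists k, i + l < pos (n + k) + W.
  exists (i + l).+1; have := block_pos_ge n (i + l).+1.
  by have := leq_pmull (i + l).+1 m_gt0; lia.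
exists n, q, (ex_minn ex); split=> //; case: ex_minnP => k // kP kmin t lt_t.
apply: (main t _).2; rewrite leqNgt; apply/negP => /kmin.
by rewrite leqNgt lt_t.
Qed.

End Morphisms.

Lemma subst_comp (A B C : Type) (f : A -> seq B) (g : B -> seq C) s :
  subst g (subst f s) = subst (fun a => subst g (f a)) s.
Proof.
elim: s => //= a s IH.
by rewrite -[subst f (a :: s)]/(f a ++ subst f s) subst_cat IH.
Qed.

Lemma image_word_comp (A B C : Type) (f : A -> seq B) (g : B -> seq C) h x y :
  image_word f h x -> image_word g x y -> image_word (fun a => subst g (f a)) h y.
Proof.
by move=> fx gy n; rewrite -subst_comp -fx gy.
Qed.

(** * Fixed points of morphisms and morphic images *)

Section FixedPoint.
Variables (A : Type) (f : A -> seq A) (a0 : A) (s0 : seq A).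
Hypotheses (fa0 : f a0 = a0 :: s0) (s0_neq0 : 0 < size s0).
Hypothesis f_gt0 : forall a, 0 < size (f a).

Definition morphism_power (k : nat) (a : A) : seq A := iter k (subst f) [:: a].

(** The iterates on [a0] are prefixes of one another and the [n]-th has more than [n] letters, so
    the default value is never read. *)
Definition fixed_point (n : nat) : A := nth a0 (morphism_power n a0) n.

Local Notation w := (morphism_power ^~ a0).

Lemma iter_subst_cat k s1 s2 :
  iter k (subst f) (s1 ++ s2) = iter k (subst f) s1 ++ iter k (subst f) s2.
Proof. by elim: k => //= k ->; rewrite subst_cat. Qed.

Lemma powerS n : w n.+1 = w n ++ iter n (subst f) s0.
Proof.
rewrite /morphism_power iterSr -iter_subst_cat.
by congr iter; rewrite /subst /= cats0 fa0.
Qed.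

Lemma power_prefix n k : exists s, w (n + k) = w n ++ s.
Proof.
elim: k => [|k [s IH]]; first by exists [::]; rewrite addn0 cats0.
exists (iter n (subst f) s0 ++ subst f s).
by rewrite addnS [LHS]/= -/(w (n + k)) IH subst_cat catA -powerS.
Qed.

Lemma size_power n : n < size (w n).
Proof.
elim: n => // n IH; apply: leq_ltn_trans IH _; rewrite powerS.
rewrite size_cat -addn1 leq_add2l.
elim: n => // n IH; apply: leq_trans IH _.
by rewrite -{1}[size _]mul1n; apply: leq_size_subst.
Qed.

Lemma nth_power n i : i < size (w n) -> nth a0 (w n) i = fixed_point i.
Proof.
move=> lt; rewrite /fixed_point.
case/orP: (leq_total n i) => le.
  by have [s] := power_prefix n (i - n); rewrite subnKC // => ->; rewrite nth_cat lt.
by have [s] := power_prefix i (n - i); rewrite subnKC // => ->; rewrite nth_cat size_power.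
Qed.

Lemma power_window n k : k <= size (w n) -> window fixed_point 0 k = take k (w n).
Proof.
move=> le; apply: (eq_from_nth (x0 := a0)) => [|i].
  by rewrite size_mkseq size_takel.
rewrite size_mkseq => lt; rewrite nth_window // nth_take // nth_power //.
exact: leq_trans lt le.
Qed.

Lemma image_fixed_point : image_word f fixed_point fixed_point.
Proof.
move=> n; rewrite (power_window (ltnW (size_power n))).
have E : w n.+1 = subst f (take n (w n)) ++ subst f (drop n (w n)).
  by rewrite -subst_cat cat_take_drop.
by rewrite (@power_window n.+1) E ?take_size_cat // size_cat leq_addr.
Qed.

Lemma image_morphism_power k :
  image_word (morphism_power k) fixed_point fixed_point.
Proof.
elim: k => [|k IH]; last exact: (image_word_comp IH image_fixed_point).
by move=> n; rewrite /subst -[map _ _]/(map (fun a => [:: a]) _) flatten_seq1 size_mkseq.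
Qed.

End FixedPoint.

Section Image.
Variables (A B : Type) (b0 : B) (g : A -> seq B) (h : nat -> A).
Hypothesis g_gt0 : forall a, 0 < size (g a).

Definition morphic_image (n : nat) : B := nth b0 (subst g (window h 0 n.+1)) n.

Lemma morphic_imageP : image_word g h morphic_image.
Proof.
move=> n; apply: (eq_from_nth (x0 := b0)); first by rewrite size_mkseq.
rewrite size_mkseq => i lt; rewrite nth_window // /morphic_image add0n.
have lt' : i < size (subst g (window h 0 i.+1)).
  by have := leq_size_subst (window h 0 i.+1) g_gt0; rewrite size_mkseq mul1n.
case/orP: (leq_total n i.+1) => le; rewrite -(subnKC le) window_cat subst_cat nth_cat.
  by rewrite lt.
by rewrite lt'.
Qed.

End Image.

(** * Finite tests for repetitions and for recognizability *)

Section Check.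
Variables (B : eqType).
Implicit Type s : seq B.

(** A linear scan for [l] consecutive [true]: [k] counts those still missing from the current run
    and returns to [l] at each [false]. *)
Fixpoint has_run (l k : nat) (e : seq bool) : bool :=
  if k is k'.+1 then
    if e is b :: e' then has_run l (if b then k' else l) e' else false
  else true.

Lemma has_run_prefix l k e : (forall t, t < k -> nth false e t) -> has_run l k e.
Proof.
elim: e k => [|b e IH] [|k] //= ke; first by have := ke 0 isT.
by have /= := ke 0 isT => ->; apply: IH => t /(ke t.+1).
Qed.

Lemma has_runP l k e r : k <= l -> (forall t, t < l -> nth false e (r + t)) -> has_run l k e.
Proof.
elim: r e k => [|r IH] e k kl le.
  by apply: has_run_prefix => t lt; apply: le; apply: leq_trans lt kl.
case: k kl => [|k] kl; first by case: (e).
case: e le => [|b e] le /=.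
  by have := le 0; rewrite nth_nil; apply; apply: leq_ltn_trans kl.
by apply: IH => [|t /le //]; case: b le => _; lia.
Qed.

Definition has_repetition (p l : nat) s : bool :=
  has_run l l [seq ab.1 == ab.2 | ab <- zip s (drop p s)].

Lemma has_repetitionP (x : nat -> B) i p l r s :
  repetition x i p l -> window x i (p + l) = take (p + l) (drop r s) ->
  has_repetition p l s.
Proof.
case: l => [|l] rep eqw; first by rewrite /has_repetition; case: (map _ _).
pose b0 := x 0.
have sz : r + p + l.+1 <= size s.
  move/(congr1 size): eqw; rewrite size_mkseq size_take_min size_drop; lia.
have nthE t : t < p + l.+1 -> nth b0 s (r + t) = x (i + t).
  by move=> lt; rewrite -nth_drop -(nth_take b0 lt) -eqw nth_window.
apply: (@has_runP _ _ _ r) => // t lt.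
have lt2 : r + t < size (zip s (drop p s)) by rewrite size_zip size_drop; lia.
rewrite (nth_map (b0, b0)) // nth_zip_cond lt2 /= nth_drop.
rewrite addnCA !nthE; [|lia..].
by rewrite addnA (rep t lt) -addnA eqxx.
Qed.
End Check.

Lemma windowS (T : Type) (x : nat -> T) i n :
  window x i n.+1 = x i :: window x i.+1 n.
Proof. by rewrite -add1n window_cat addn1 /window /= addn0. Qed.

Section Recognizable.
Variables (A B : eqType) (f : A -> seq B) (h : nat -> A) (x : nat -> B) (m : nat).
Hypotheses (m_gt0 : 0 < m) (size_ge : forall a, m <= size (f a)).
Hypothesis imx : image_word f h x.

Definition factors_of_pairs (K : nat) (F : A -> seq B) (L : seq (A * A)) : seq (seq B) :=
  undup (flatten [seq [seq take K (drop r (F ab.1 ++ F ab.2)) | r <- iota 0 (size (F ab.1))]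
                 | ab <- L]).

(** A window of at most [m + 1] letters meets no more than two consecutive blocks. *)
Lemma factors_of_pairsP K L : (forall n, (h n, h n.+1) \in L) -> K <= m + 1 ->
  forall i, window x i K \in factors_of_pairs K f L.
Proof.
move=> hL Km i; rewrite mem_undup.
have [|n [r [_ lt ->]]] := window_infix m_gt0 size_ge imx (N := K) i (k := 1).
  by rewrite muln1.
apply/flattenP.
exists [seq take K (drop r (f (h n) ++ f (h n.+1))) | r <- iota 0 (size (f (h n)))].
  by apply/mapP; exists (h n, h n.+1).
apply/mapP; exists r; first by rewrite mem_iota.
by rewrite /window /subst /= cats0 addn0 addn1.
Qed.

Definition separates_blocks (W : nat) (L : seq (seq A)) : bool :=
  all (fun u => all (fun v =>
    if (u, v) is (a :: _, b :: _) then
      all (fun r => (take W (subst f u) == take W (drop r (subst f v))) ==>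
                    (r == 0) && (a == b)) (iota 0 (size (f b)))
    else true) L) L.

(** Wherever a window of [W] letters starts in a block, it is covered by [K.+1] consecutive blocks,
    so recognizability reduces to comparing images of the finitely many words in [L]. *)
Lemma separates_blocks_recognizable W K L :
  (forall n, window h n K.+1 \in L) -> W <= m * K + 1 -> separates_blocks W L ->
  recognizable f h x W.
Proof.
move=> hL WK /allP sep n j eqw.
have [k [r [jE lt jw]]] := window_infix m_gt0 size_ge imx j WK.
have nw : window x (block_pos f h n) W = take W (subst f (window h n K.+1)).
  rewrite -(window_block imx) -[window _ _ (size _)]drop0 take_drop_window ?addn0 //.
  have := leq_size_subst (window h n K.+1) size_ge; rewrite size_mkseq mulnS.
  by lia.
have := sep _ (hL n) => /allP /(_ _ (hL k)).
rewrite !windowS => /allP /(_ r); rewrite mem_iota => /(_ lt).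
rewrite -!windowS -nw -jw eqw eqxx => /andP[/eqP r0 /eqP ->].
by exists k; rewrite // jE r0 addn0.
Qed.
End Recognizable.

(** * The words theta and gamma(theta) *)

(* The letters Sa, Sb are the states reached by reading a digit 1. *)
Inductive letter := La | Lb | Lc | Sa | Sb.

Definition letter_code (a : letter) : nat :=
  match a with La => 0 | Lb => 1 | Lc => 2 | Sa => 3 | Sb => 4 end.
Definition letter_decode (n : nat) : option letter :=
  nth None [:: Some La; Some Lb; Some Lc; Some Sa; Some Sb] n.
Lemma letter_codeK : pcancel letter_code letter_decode. Proof. by case. Qed.

HB.instance Definition _ := Countable.copy letter (pcan_type letter_codeK).
Lemma letter_enumP : Finite.axiom [:: La; Lb; Lc; Sa; Sb].
Proof. by case. Qed.
HB.instance Definition _ := isFinite.Build letter letter_enumP.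

(** This is also a transition table on Zeckendorf digits: digit 0 leads to the first letter of the
    block, digit 1 to the second. [Sa] and [Sb] have one-letter blocks because a 1 must be followed
    by 0. *)
Definition phi (a : letter) : seq letter :=
  match a with
  | La => [:: La; Sa] | Lb => [:: Lc; Sa] | Lc => [:: La; Sb]
  | Sa => [:: Lb] | Sb => [:: La]
  end.

Definition digits (s : seq nat) : seq bool := map (eq_op 1) s.

(* Found by computer search among the morphisms with block lengths 13 and 8. *)
Definition gamma (a : letter) : seq bool :=
  digits match a with
  | La => [:: 0; 0; 1; 0; 1; 1; 0; 1; 0; 0; 1; 1; 0]
  | Lb => [:: 0; 0; 1; 0; 1; 1; 0; 0; 1; 0; 0; 1; 1]
  | Lc => [:: 0; 1; 0; 0; 1; 1; 0; 1; 1; 0; 0; 1; 0]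
  | Sa => [:: 1; 1; 0; 0; 1; 1; 0; 1]
  | Sb => [:: 0; 1; 0; 0; 1; 1; 0; 1]
  end.

Definition theta : nat -> letter := fixed_point phi La.
Definition xi : nat -> bool := morphic_image false gamma theta.

Definition theta_factors2 : seq (letter * letter) :=
  [:: (La, Lc); (La, Sa); (La, Sb); (Lb, La); (Lb, Lc); (Lc, Sa); (Sa, La);
      (Sa, Lb); (Sb, Lb)].

Lemma theta_power k : image_word (morphism_power phi k) theta theta.
Proof. by apply: (@image_morphism_power _ phi La [:: Sa]) => // -[]. Qed.

Lemma xi_image : image_word gamma theta xi.
Proof. by apply: morphic_imageP => -[]. Qed.

(** Blocks of [phi] iterated twice have at least two letters, so the pair at [n > 0] comes from the
    image of a pair at some [k < n]; the list is closed under this passage. *)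
Lemma mem_theta_factors2 n : (theta n, theta n.+1) \in theta_factors2.
Proof.
elim/ltn_ind: n => n IH.
have ge2 (a : letter) : 2 <= size (morphism_power phi 2 a) by case: a.
have [k [r [nE lt eqw]]] :=
  window_infix (isT : 0 < 2) ge2 (theta_power 2) n (isT : 2 <= 2 * 1 + 1).
have [->|n_gt0] := posnP n; first by vm_compute.
have lt_kn : k < n.
  have le : 2 * k <= block_pos (morphism_power phi 2) theta k.
    exact: leq_trans (leq_addl _ _) (block_pos_ge theta ge2 0 k).
  by rewrite nE in n_gt0 *; case: (posnP k); lia.
move: (IH _ lt_kn) lt eqw; rewrite /window /subst /= cats0 !addn0 !addn1.
have check : all (fun ab => all (fun r =>
    let s := take 2 (drop r (morphism_power phi 2 ab.1 ++ morphism_power phi 2 ab.2)) in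
    (nth La s 0, nth La s 1) \in theta_factors2)
  (iota 0 (size (morphism_power phi 2 ab.1)))) theta_factors2 by [].
move=> /(allP check) /= /allP /(_ r); rewrite mem_iota => + lt eqw.
by rewrite -eqw !nth_mkseq // addn0 addn1; apply.
Qed.

Lemma theta_recognizable : recognizable (morphism_power phi 2) theta theta 4.
Proof.
(* Blocks of length at least 5 ensure that three consecutive letters of [theta] lie in two adjacent
   blocks. *)
have ge (a : letter) : 5 <= size (morphism_power phi 4 a) by case: a.
apply: (@separates_blocks_recognizable _ _ _ _ _ 2 _ _ _ _ 2
  (factors_of_pairs 3 (morphism_power phi 4) theta_factors2)); [by []|by case| | |by []|].
- exact: theta_power.
- move=> n; apply: (@factors_of_pairsP _ _ _ _ _ 5 _ _ (theta_power 4) 3) => //.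
  exact: mem_theta_factors2.
- by vm_compute.
Qed.

Lemma xi_recognizable : recognizable gamma theta xi 13.
Proof.
have ge (a : letter) : 5 <= size (morphism_power phi 4 a) by case: a.
apply: (@separates_blocks_recognizable _ _ _ _ _ 8 _ _ _ _ 3
  (factors_of_pairs 4 (morphism_power phi 4) theta_factors2)); [by []|by case| | |by []|].
- exact: xi_image.
- move=> n; apply: (@factors_of_pairsP _ _ _ _ _ 5 _ _ (theta_power 4) 4) => //.
  exact: mem_theta_factors2.
- by vm_compute.
Qed.

Definition free_of_repetitions (B : eqType) (F : letter -> seq B) (P : nat) (l : nat -> nat) :=
  all (fun ab => let s := F ab.1 ++ F ab.2 in
    all (fun p => ~~ has_repetition p (l p) s) (iota 1 P)) theta_factors2.

(** The bound on [p + l p] confines the whole repetition to two adjacent blocks, and these form one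
    of the tested words. *)
Lemma free_of_repetitionsP (B : eqType) (F : letter -> seq B) x P l m :
  0 < m -> (forall a, m <= size (F a)) -> image_word F theta x ->
  free_of_repetitions F P l ->
  forall i p, 0 < p <= P -> p + l p <= m + 1 -> ~ repetition x i p (l p).
Proof.
move=> m_gt0 size_ge imx free i p pP ple rep.
have [|n [r [_ lt]]] := window_infix m_gt0 size_ge imx (N := p + l p) i (k := 1).
  by rewrite muln1.
rewrite /window /subst /= cats0 addn0 addn1 -/(window _ _ _) => eqw.
have := allP free _ (mem_theta_factors2 n) => /allP /(_ p).
rewrite mem_iota add1n ltnS => /(_ pP) /negP; apply.
exact: has_repetitionP rep eqw.
Qed.

(* The critical exponent of theta is about 1.807, so a long p-periodic run misses a
   square by much more than four letters; this slack absorbs the letters lost in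
   repetition_desubst, since (4 + 5)./2 = 4. *)
Definition theta_gap (p : nat) : nat := if p < 21 then p else p - 4.

Lemma theta_free_small : free_of_repetitions (morphism_power phi 11) 62 theta_gap.
Proof. by vm_compute. Qed.

(** The least [l] with [4 * p < 3 * l], that is, with exponent [(l + p) / p] above 7/3. *)
Definition xi_gap (p : nat) : nat := ((4 * p) %/ 3).+1.

Lemma xi_free_small :
  free_of_repetitions (fun a => subst gamma (morphism_power phi 7 a)) 72 xi_gap.
Proof. by vm_compute. Qed.

Lemma repetitionW (T : Type) (x : nat -> T) i p k l :
  k <= l -> repetition x i p l -> repetition x i p k.
Proof. by move=> kl rep t tk; apply: rep; apply: leq_trans tk kl. Qed.

Lemma theta_free p i : 0 < p -> ~ repetition theta i p (theta_gap p).
Proof.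
elim/ltn_ind: p i => p IH i p_gt0 rep.
(* Blocks have at most 3 letters, so [p > 62] gives [q > 20] below, where [theta_gap q] is
   [q - 4]. *)
have [small|large] := leqP p 62.
  have ge (a : letter) : 144 <= size (morphism_power phi 11 a) by case: a.
  apply: (free_of_repetitionsP (isT : 0 < 144) ge (theta_power 11) theta_free_small _ _ rep).
    by rewrite p_gt0.
  by rewrite /theta_gap; case: ifP; lia.
have ge2 (a : letter) : 2 <= size (morphism_power phi 2 a) by case: a.
have le3 (a : letter) : size (morphism_power phi 2 a) <= 3 by case: a.
have gapE q : 20 < q -> theta_gap q = q - 4.
  by move=> lt; rewrite /theta_gap ltnNge lt.
rewrite gapE in rep; last by lia.
have [|n [q [k [q_gt0 qp rep' lo hi]]]] :=
  repetition_desubst (isT : 0 < 2) ge2 le3 theta_recognizable p_gt0 _ rep.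
  by lia.
have := block_pos_ge theta ge2 n q; have := block_pos_le theta le3 n q => q3 q2.
apply: (IH q _ n) => //; first by lia.
rewrite gapE; last by lia.
apply: repetitionW rep'.
(* If [k < q - 4], the blocks from [n + k] up to [n + q] take at least 10 letters, while [lo] and
   [hi] leave room for 9 only. *)
have [//|lt] := leqP (q - 4) k.
have := block_pos_ge theta ge2 (n + k) (q - k).
rewrite -addnA subnKC; last by lia.
by lia.
Qed.

Lemma xi_free p l i : 0 < p -> 4 * p < 3 * l -> ~ repetition xi i p l.
Proof.
move=> p_gt0 pl rep.
have [small|large] := leqP p 72.
  have ge (a : letter) : 233 <= size (subst gamma (morphism_power phi 7 a)) by case: a.
  have im := image_word_comp (theta_power 7) xi_image.
  have nrep : ~ repetition xi i p (xi_gap p).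
    apply: (free_of_repetitionsP (isT : 0 < 233) ge im xi_free_small).
      by rewrite p_gt0.
    by rewrite /xi_gap; have := leq_trunc_div (4 * p) 3; lia.
  by apply: nrep; apply: repetitionW rep; rewrite ltn_divLR // [l * 3]mulnC.
have ge (a : letter) : 8 <= size (gamma a) by case: a.
have le (a : letter) : size (gamma a) <= 13 by case: a.
have [|n [q [k [q_gt0 qp rep' lo hi]]]] :=
  repetition_desubst (isT : 0 < 8) ge le xi_recognizable p_gt0 _ rep.
  by lia.
apply: (@theta_free q n q_gt0); apply: repetitionW rep'.
(* Otherwise [lo], [hi] and one block of at least 8 letters give [l <= p + 16], but [4 * p < 3 * l]
   with [p > 72] makes [l - p] exceed 24. *)
have qk : q <= k.
  rewrite leqNgt; apply/negP => lt.
  have := block_pos_ge theta ge (n + k) (q - k).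
  by rewrite -addnA subnKC; lia.
by rewrite /theta_gap; case: ifP; lia.
Qed.

(** * Zeckendorf representations *)

Arguments fib : simpl never.

Lemma fibSS n : fib n.+2 = fib n.+1 + fib n.
Proof. by []. Qed.

Definition no_two_ones (w : seq bool) : bool := sorted (fun a b => ~~ (a && b)) w.

Lemma fib_value_cons b w : fib_value (b :: w) = b * fib (size w).+2 + fib_value w.
Proof.
rewrite /fib_value big_ord_recl subn0 addn1; congr (_ + _).
by apply: eq_bigr => i _; rewrite lift0 /= subSS addn1.
Qed.

Lemma fib_value_nil : fib_value [::] = 0.
Proof. exact: big_ord0. Qed.

Lemma fib_value_zeros_cat k w : fib_value (nseq k false ++ w) = fib_value w.
Proof. by elim: k => //= k IH; rewrite fib_value_cons mul0n. Qed.

Lemma fib_value_zeros k : fib_value (nseq k false) = 0.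
Proof. by rewrite -[nseq k _]cats0 fib_value_zeros_cat fib_value_nil. Qed.

Lemma fib_value_cat u v :
  fib_value (u ++ v) = fib_value (u ++ nseq (size v) false) + fib_value v.
Proof.
elim: u => [|b u IH]; last first.
  by rewrite !cat_cons !fib_value_cons IH !size_cat size_nseq addnA.
by rewrite /= fib_value_zeros.
Qed.

Lemma fib_value_rcons u b k :
  fib_value (rcons u b ++ nseq k false) = fib_value (u ++ nseq k.+1 false) + b * fib k.+2.
Proof.
rewrite cat_rcons fib_value_cat /= size_nseq fib_value_cons size_nseq.
by rewrite fib_value_zeros addn0.
Qed.

(** After a leading 1 the next digit is 0, which gives the sharper bound on the tail that the
    Fibonacci recurrence needs. *)
Lemma fib_value_lt w :
  no_two_ones w -> fib_value w < fib (size w + head false w).+1.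
Proof.
elim: w => [|b w IH] bw; first by rewrite fib_value_nil.
have {IH} := IH (path_sorted bw); rewrite fib_value_cons [size (b :: w)]/=.
case: b bw => bw /=; rewrite ?addn1 ?addn0 ?mul1n ?mul0n ?add0n.
  have -> : head false w = false by case: w bw => [|[]].
  by rewrite addn0 [fib _.+3]fibSS ltn_add2l.
by case: (head false w); rewrite ?addn1 ?addn0 // => /leq_trans; apply; rewrite fibSS leq_addr.
Qed.

Definition long (a : letter) : bool :=
  match a with La | Lb | Lc => true | _ => false end.

Definition phi_step (a : letter) (b : bool) : letter := nth La (phi a) b.

Lemma iter_subst_power (A : Type) (f : A -> seq A) k s :
  iter k (subst f) s = subst (morphism_power f k) s.
Proof.
elim: s => [|a s IH]; first by elim: k => //= k ->.
by rewrite -cat1s iter_subst_cat IH.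
Qed.

Lemma morphism_powerSr (A : Type) (f : A -> seq A) k a :
  morphism_power f k.+1 a = subst (morphism_power f k) (f a).
Proof. by rewrite /morphism_power iterSr {2}/subst /= cats0 iter_subst_power. Qed.

Lemma size_phi_power k a :
  size (morphism_power phi k a) = fib (if long a then k.+2 else k.+1).
Proof.
elim: k a => [|k IH] a; first by case: a.
rewrite morphism_powerSr /subst.
by case: a => /=; rewrite ?size_cat !IH /= ?addn0.
Qed.

Lemma block_pos_power k n :
  block_pos (morphism_power phi k) theta (block_pos phi theta n) =
  block_pos (morphism_power phi k.+1) theta n.
Proof.
rewrite /block_pos (image_fixed_point (s0 := [:: Sa])) // ?subst_comp; last by case.
by congr size; congr flatten; apply: eq_map => a; rewrite -morphism_powerSr.
Qed.

Lemma long_run u : last false u = false -> long (foldl phi_step La u).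
Proof.
case/lastP: u => // u b; rewrite last_rcons foldl_rcons => ->.
by case: (foldl _ _ _).
Qed.

(** Letter number [fib_value u] of [theta] produces the block starting at the value of [u] followed
    by 0; appending a digit selects a letter of that block. Iterating [phi] appends further
    zeros. *)
Lemma run_spec u : no_two_ones u ->
  theta (fib_value u) = foldl phi_step La u /\
  forall k, block_pos (morphism_power phi k) theta (fib_value u) =
            fib_value (u ++ nseq k false).
Proof.
elim/last_ind: u => [_|u b IH ub].
  by rewrite fib_value_nil; split=> // k; rewrite fib_value_zeros.
have [|hu posu] := IH; first by move: ub; rewrite /no_two_ones -cats1 => /cat_sorted2[].
have b_lt : b < size (phi (foldl phi_step La u)).
  case: b ub => [ub|_]; last by case: (foldl _ _ _).
  suff : long (foldl phi_step La u) by case: (foldl _ _ _).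
  apply: long_run; case/lastP: u ub {IH hu posu} => // u c.
  by rewrite last_rcons /no_two_ones -!cats1 -catA => /cat_sorted2[_] /=; case: c.
have im : image_word phi theta theta by apply: (image_fixed_point (s0 := [:: Sa])) => // -[].
have valE0 : fib_value (u ++ nseq 1 false) = block_pos phi theta (fib_value u).
  rewrite -posu; congr size; congr flatten; apply: eq_map => a.
  by rewrite /morphism_power /= /subst /= cats0.
have shift t : t < size (phi (foldl phi_step La u)) ->
    theta (fib_value (u ++ nseq 1 false) + t) = nth La (phi (foldl phi_step La u)) t.
  move=> lt; have := window_letter im (fib_value u); rewrite hu -valE0.
  by move=> <-; rewrite nth_window.
have valE : fib_value (rcons u b) = fib_value (u ++ nseq 1 false) + b.
  by rewrite -[rcons u b]cats0 (fib_value_rcons u b 0) muln1.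
split; first by rewrite foldl_rcons valE shift.
move=> k; rewrite fib_value_rcons valE -[in RHS]posu.
rewrite -block_pos_power -valE0.
(* For digit 1 one block is skipped, that of the first letter of a two-letter image; this letter is
   [La] or [Lc], hence long. *)
case: b {ub valE} b_lt => b_lt /=; last by rewrite mul0n !addn0.
rewrite addn1 block_posS mul1n size_phi_power; congr (_ + fib _).
have := shift 0; rewrite addn0 => ->; last exact: leq_ltn_trans b_lt.
by case: (foldl _ _ _).
Qed.

(** * An automaton with output for [xi] *)

Definition buffer_step (s : letter * 5.-tuple bool) (b : bool) : letter * 5.-tuple bool :=
  (phi_step s.1 (thead s.2), [tuple of rcons (behead s.2) b]).

(** The letter lags five digits behind the input. The initial five zeros act as leading zeros: they
    keep the letter at [La] and add nothing to the value. *)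
Definition xi_dfao : dfao bool bool :=
  @Dfao bool bool (letter * 5.-tuple bool)%type (La, [tuple of nseq 5 false]) buffer_step
    (fun s => nth false (gamma s.1) (fib_value s.2)).

Lemma buffer_run s w :
  let t := tval s.2 ++ w in
  (foldl buffer_step s w).1 = foldl phi_step s.1 (take (size w) t) /\
  tval (foldl buffer_step s w).2 = drop (size w) t.
Proof.
elim: w s => [|b w IH] [a t] /=; first by rewrite take0 drop0 cats0.
have [-> ->] := IH (buffer_step (a, t) b).
case/tupleP: t => c t /=.
by rewrite theadE cat_rcons.
Qed.

Lemma size_gamma a : size (gamma a) = fib (if long a then 7 else 6).
Proof. by case: a. Qed.

Lemma block_pos_gamma n : block_pos gamma theta n = block_pos (morphism_power phi 5) theta n.
Proof.
by elim: n => // n IH; rewrite !block_posS IH size_gamma size_phi_power.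
Qed.

(** The value of [u] followed by five zeros is where block number [fib_value u] of [gamma] starts,
    and [fib_value v] is the offset in it. *)
Lemma xi_run u v : no_two_ones (u ++ v) -> size v = 5 ->
  nth false (gamma (foldl phi_step La u)) (fib_value v) = xi (fib_value (u ++ v)).
Proof.
move=> uv sv; have [su sv'] := cat_sorted2 uv.
have [hu posu] := run_spec su.
rewrite fib_value_cat sv -posu -block_pos_gamma -hu.
have lt : fib_value v < size (gamma (theta (fib_value u))).
  rewrite size_gamma hu; apply: leq_trans (fib_value_lt sv') _; rewrite sv.
  (* A short letter means that [u] ends in 1, so [v] starts with 0 and its value is below 8 instead
     of 13. *)
  case: (long _) (@long_run u) => [_|ul]; first by case: (head _ _).
  suff -> : head false v = false by [].
  case: (lastP u) ul uv => [/(_ erefl) //|u' [] ul].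
    2: by have := ul; rewrite last_rcons => /(_ erefl).
  rewrite /no_two_ones -cats1 -catA => /cat_sorted2[_].
  by case: (v) => [|[]].
by rewrite -[in LHS](window_letter xi_image) nth_window.
Qed.

Lemma xi_fib_automatic : fib_automatic xi.
Proof.
exists xi_dfao => n w /and3P[_ sw /eqP <-].
have [] := buffer_run (La, [tuple of nseq 5 false]) w.
rewrite /dfao_run [tval _]/= /= => -> ->.
rewrite xi_run ?cat_take_drop ?(fib_value_zeros_cat 5) //.
  by case: w sw => [|[]].
by rewrite size_drop /=; lia.
Qed.

(** * Repetitions forced by a finite automaton *)

Lemma no_two_ones_of_lt n t : t < fib n.+2 ->
  exists v, [/\ size v = n, no_two_ones v & fib_value v = t].
Proof.
elim/ltn_ind: n t => -[|n] IH t lt.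
  by exists [::]; split=> //; rewrite fib_value_nil; move: lt; rewrite ltnS leqn0 => /eqP.
have [lt'|ge] := ltnP t (fib n.+2).
  have [v [sv nv vt]] := IH n (ltnSn n) t lt'.
  exists (false :: v); rewrite fib_value_cons mul0n /= sv vt; split=> //.
  by move: nv; rewrite /no_two_ones /=; case: (v).
(* The greedy choice of a leading 1 fixes two digits, 1 and 0, so length one is treated apart. *)
case: n IH lt ge => [|n] IH lt ge.
  exists [:: true]; rewrite fib_value_cons fib_value_nil; split=> //.
  by case: t lt ge => [|[|t]].
have [||v [sv nv vt]] := IH n _ (t - fib n.+3).
- by rewrite ltnW.
- by move: lt; rewrite [fib n.+4]fibSS; lia.
exists [:: true, false & v]; rewrite !fib_value_cons mul0n mul1n add0n /= sv vt; split=> //.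
  by move: nv; rewrite /no_two_ones /=; case: (v).
by rewrite subnKC.
Qed.

Lemma pigeonhole_repeat (T : finType) (s : nat -> T) : exists a b, a < b /\ s a = s b.
Proof.
have /injectivePn [a [b ne eq]] : ~~ injectiveb (fun i : 'I_#|T|.+1 => s i).
  apply/negP => /injectiveP /leq_card; rewrite card_ord; lia.
case: (ltngtP a b) => [lt|lt|/ord_inj e]; first by exists a, b.
  by exists b, a.
by rewrite e eqxx in ne.
Qed.

Lemma fib_mono m n : m <= n -> fib m <= fib n.
Proof.
move/subnKC <-; elim: (n - m) => [|k IH]; first by rewrite addn0.
apply: leq_trans IH _; rewrite addnS; case: (m + k) => // j.
by rewrite fibSS leq_addr.
Qed.

Lemma fib_lt n : fib n.+2 < fib n.+3.
Proof.
rewrite [fib n.+3]fibSS -[X in X < _]addn0 ltn_add2l.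
by elim: n => // n IH; rewrite fibSS ltn_addr.
Qed.

Lemma fib_gt n : n <= fib n.+1.
Proof.
elim: n => // -[|n] IH //; apply: leq_ltn_trans IH (fib_lt n).
Qed.

(* The prefixes [1 0^a] and [1 0^b] lead to the same state, so the blocks of length
   [fib n.+2] reached from them by n further digits coincide. *)
Lemma fib_automatic_repetition (B : Type) (x : nat -> B) : fib_automatic x ->
  exists a b, a < b /\ forall n,
    repetition x (fib (a + n).+3) (fib (b + n).+3 - fib (a + n).+3) (fib n.+2).
Proof.
case=> M Mx.
(* At least one 0 follows the leading 1, so any admissible [v] may come next, even one starting with
   1. *)
pose q k := foldl (@dfao_step _ _ M) (dfao_init M) (true :: nseq k.+1 false).
have [a [b [lt_ab qab]]] := pigeonhole_repeat q.
have out k n t v : size v = n -> no_two_ones v -> fib_value v = t ->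
    x (fib (k + n).+3 + t) = dfao_out (foldl (@dfao_step _ _ M) (q k) v).
  move=> sv nv vt; rewrite -foldl_cat; apply/esym/Mx/and3P; split=> //.
    rewrite /= /no_two_ones in nv *; elim: k => [|k IH] /=; last exact: IH.
    by case: (v) nv.
  rewrite cat_cons fib_value_cons fib_value_zeros_cat vt mul1n.
  by rewrite size_cat size_nseq sv addSn.
exists a, b; split=> // n t lt; rewrite subnKC; last first.
  by apply: fib_mono; rewrite !ltnS leq_add2r ltnW.
have [v [sv nv vt]] := no_two_ones_of_lt lt.
by rewrite !(out _ _ _ _ sv nv vt) qab.
Qed.

(* All exponents are below 7/3: the repetition covers l + p letters, and
   7 p <= 3 (l + p). *)
Definition low_exponent (T : Type) (x : nat -> T) : Prop :=
  forall i p l, 0 < p -> 4 * p <= 3 * l -> ~ repetition x i p l.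

(** * Words with all exponents below 7/3 *)

Section Desubstitution.
Variable x : nat -> bool.
Hypothesis xlow : low_exponent x.

Let twin i := x i == x i.+1.

(** The shortest repetitions of periods 1, 2 and 3 with exponent at least 7/3 have lengths 3, 5 and
    7. *)
Lemma low_exponent_patterns i :
  [/\ ~~ [&& x i == x i.+1 & x i.+1 == x i.+2],
      ~~ [&& x i == x i.+2, x i.+1 == x i.+3 & x i.+2 == x i.+4] &
      ~~ [&& x i == x i.+3, x i.+1 == x i.+4, x i.+2 == x i.+4.+1 & x i.+3 == x i.+4.+2]].
Proof.
split; apply/negP.
- move=> /andP[/eqP e0 /eqP e1]; apply: (xlow (i := i) (p := 1) (l := 2)) => // t.
  by case: t => [|[]] // _; rewrite ?addn0 ?addn1.
- move=> /and3P[/eqP e0 /eqP e1 /eqP e2]; apply: (xlow (i := i) (p := 2) (l := 3)) => // t.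
  by case: t => [|[|[]]] // _; rewrite ?addnS ?addn0.
- move=> /and4P[/eqP e0 /eqP e1 /eqP e2 /eqP e3].
  apply: (xlow (i := i) (p := 3) (l := 4)) => // t.
  by case: t => [|[|[|[]]]] // _; rewrite ?addnS ?addn0.
Qed.

Lemma twin_exists i : exists2 d, d < 4 & twin (i + d).
Proof.
have [_ + _] := low_exponent_patterns i.
have [d0|d0] := boolP (twin i); first by exists 0; rewrite ?addn0.
have [d1|d1] := boolP (twin i.+1); first by exists 1; rewrite ?addn1.
have [d2|d2] := boolP (twin i.+2); first by exists 2; rewrite ?addn2.
have [d3|d3] := boolP (twin i.+3); first by exists 3; rewrite ?addn3.
move: d0 d1 d2 d3; rewrite /twin.
by case: (x i); case: (x i.+1); case: (x i.+2); case: (x i.+3); case: (x i.+4).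
Qed.

(** Distance 1 would give a cube, and absence of twins at distances 1 to 4 would give [ababa]. At
    distance 3 the word [aabaa] extends to [baabaab], of period 3; this uses the letter before the
    twin. *)
Lemma next_twin i : twin i.+1 ->
  [/\ ~~ twin i.+2, ~~ twin i.+4 & twin i.+3 || twin i.+4.+1].
Proof.
have [_ _] := low_exponent_patterns i.
have [] := low_exponent_patterns i.+1; have [] := low_exponent_patterns i.+2.
have [] := low_exponent_patterns i.+3; have [] := low_exponent_patterns i.+4.
have [+ _ _] := low_exponent_patterns i; rewrite /twin => + + _ _ + _ _ + + _ + _ _.
case: (x i); case: (x i.+1); case: (x i.+2); case: (x i.+3); case: (x i.+4);
  by case: (x i.+4.+1); case: (x i.+4.+2).
Qed.

(** Consecutive twins are 2 or 4 apart by [next_twin]. Position 0 is excluded as it has no preceding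
    letter. *)
Lemma twin_parity i j : 0 < i -> 0 < j -> twin i -> twin j -> odd i = odd j.
Proof.
wlog le : i j / i <= j.
  by move=> W; case/orP: (leq_total i j) => le *; [|apply: esym]; apply: W.
have [n] := ubnP (j - i); elim: n i le => // n IH i le bd i_gt0 j_gt0 di dj.
case: i i_gt0 le bd di => // i _ le bd di.
have [d2 d4 /orP d35] := next_twin di.
have [->|ne1] := eqVneq j i.+1; first by [].
have [e|ne2] := eqVneq j i.+2; first by rewrite e in dj; rewrite dj in d2.
have [->|ne3] := eqVneq j i.+3; first by rewrite /= negbK.
have [e|ne4] := eqVneq j i.+4; first by rewrite e in dj; rewrite dj in d4.
case: d35 => d.
  by rewrite -(IH i.+3) //=; [rewrite negbK|lia|lia].
by rewrite -(IH i.+4.+1) //=; [rewrite !negbK|lia|lia].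
Qed.

(** Some twin lies within the first six letters of the repetition; its copy [p] places later is a
    twin too and has the same parity. *)
Lemma repetition_even i p l : 5 < l -> repetition x i p l -> ~~ odd p.
Proof.
move=> l5 rep; have [d d4 dd] := twin_exists i.+1.
have dd' : twin (i + p + d.+1).
  by rewrite /twin -addnS -!rep ?addnS -?addSn //; lia.
have := twin_parity _ _ dd dd'.
rewrite addnS !addSn /= !oddD => /(_ isT isT).
by case: (odd i); case: (odd d); case: (odd p).
Qed.

(* x is [u mu(y)] with [|u| = e] and mu the Thue-Morse morphism. *)
Lemma desubstitution : exists e, [/\ 0 < e <= 2,
  forall m, x (e + m.*2).+1 = ~~ x (e + m.*2) & low_exponent (fun m => x (e + m.*2))].
Proof.
have [d d4 dd] := twin_exists 1.
(* The parity of [e] is opposite to that of all twins at positive positions, so no pair starting at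
   [e + m.*2] is a twin. *)
pose e := if odd d then 1 else 2.
have e_gt0 : 0 < e by rewrite /e; case: ifP.
have alt m : x (e + m.*2).+1 = ~~ x (e + m.*2).
  suff : ~~ twin (e + m.*2).
    by rewrite /twin; case: (x _); case: (x _).
  apply/negP => dm; have := twin_parity _ _ dd dm.
  rewrite !addn_gt0 e_gt0 /= !oddD odd_double addbF /e => /(_ isT isT).
  by case: (odd d).
exists e; split=> //; first by rewrite e_gt0 /e; case: ifP.
move=> i p l p_gt0 pl rep; apply: (xlow (i := e + i.*2) (p := p.*2) (l := l.*2)).
- by rewrite double_gt0.
- by lia.
move=> t lt; rewrite -(odd_double_half t).
have /rep : t./2 < l by lia.
rewrite !doubleD !addnA => eq; case: (odd t); last by rewrite !addn0 eq.
rewrite [_ + true + _]addnAC [_ + p.*2 + true + _]addnAC !addn1 -!addnA -!doubleD !alt.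
by rewrite !doubleD !addnA eq.
Qed.

End Desubstitution.

Lemma repetition_dvd k (x : nat -> bool) i p l : low_exponent x -> repetition x i p l ->
  7 * 2 ^ k <= l.+1 -> 2 ^ k %| p.
Proof.
elim: k x i p l => [|k IH] x i p l xlow rep kl; first exact: dvd1n.
have k_gt0 : 0 < 2 ^ k by rewrite expn_gt0.
have p_even : ~~ odd p by apply: (repetition_even xlow _ rep); rewrite expnS in kl; lia.
have pE : p = p./2.*2 by rewrite even_halfK.
have [e [e12 alt ylow]] := desubstitution xlow.
rewrite pE -mul2n expnS dvdn_pmul2l //.
(* In [x] the halved repetition starts at [e + i./2.*2], at most two letters after [i]; the form
   [7 * 2 ^ k - 1] of the length absorbs this loss. *)
apply: (IH _ i./2 _ (7 * 2 ^ k).-1 ylow) => [t lt|]; last by lia.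
have := rep (e + i./2.*2 + t.*2 - i).
rewrite {1}pE !doubleD.
have := odd_double_half i; set c := nat_of_bool _ => iE; have : c <= 1 by rewrite leq_b1.
have -> : i + (e + i./2.*2 + t.*2 - i) = e + (i./2.*2 + t.*2) by lia.
have -> : i + p./2.*2 + (e + i./2.*2 + t.*2 - i) = e + (i./2.*2 + p./2.*2 + t.*2) by lia.
by move=> c1; apply; rewrite expnS in kl; lia.
Qed.

Lemma fib_automatic_not_low (x : nat -> bool) : fib_automatic x -> ~ low_exponent x.
Proof.
move=> /fib_automatic_repetition[a [b [ab rep]]] xlow.
pose D n := fib (b + n).+3 - fib (a + n).+3.
have DE n : D n + fib (a + n).+3 = fib (b + n).+3.
  by rewrite subnK // fib_mono // !ltnS leq_add2r ltnW.
have D0 : 0 < D 0.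
  rewrite subn_gt0 !addn0; apply: leq_trans (fib_lt a.+1) _.
  by apply: fib_mono; rewrite !ltnS.
have DSS n : D n.+2 = D n.+1 + D n.
  by have := DE n; have := DE n.+1; have := DE n.+2; rewrite !addnS ![fib _.+4.+1]fibSS; lia.
have big k n : 7 * 2 ^ k <= n -> 2 ^ k %| D n.
  move=> le; apply: repetition_dvd xlow (rep n) _.
  by apply: leq_trans le _; apply: leq_trans (fib_gt n) _; apply: leqW; apply: fib_mono.
(* The recurrence is run backwards: a common divisor of two consecutive terms divides the preceding
   one. *)
have all_n k n : 2 ^ k %| D n -> 2 ^ k %| D n.+1 -> 2 ^ k %| D 0.
  elim: n => // n IH d1 d2; apply: IH => //.
  by move: d2; rewrite DSS dvdn_addr.
(* With exponent [D 0] itself, [2 ^ D 0] would divide the positive number [D 0], which is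
   smaller. *)
have := all_n _ _ (big (D 0) _ (leqnn _)) (big _ _ (leqnSn _)).
by move=> /(dvdn_leq D0); rewrite leqNgt ltn_expl.
Qed.

(** * Critical exponents *)

Lemma is_periodP (T : eqType) (x : nat -> T) i n p :
  reflect ((0 < p <= n) /\ repetition x i p (n - p)) (is_period (window x i n) p).
Proof.
have onthE j : j < n -> onth (window x i n) j = Some (x (i + j)).
  by move=> lt; rewrite onthE (nth_map (x 0)) ?size_mkseq // nth_window.
rewrite /is_period size_mkseq; apply: (iffP andP) => -[pn eq]; split=> //.
  move=> t lt; have /forallP/(_ (Ordinal lt))/eqP /= := eq.
  by rewrite !onthE; [case=> ->; rewrite -addnA [t + p]addnC|lia|lia].
apply/forallP => -[t lt] /=; rewrite !onthE; [|lia|lia].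
by rewrite (eq t lt) -addnA [t + p]addnC.
Qed.

Lemma is_period_size (T : eqType) (w : seq T) : 0 < size w -> is_period w (size w).
Proof.
move=> w_gt0; rewrite /is_period w_gt0 leqnn /=.
by apply/forallP => -[t]; rewrite subnn.
Qed.

Lemma min_periodP (T : eqType) (w : seq T) : 0 < size w -> is_period w (min_period w).
Proof.
move=> w_gt0; have has_p : has (is_period w) (iota 0 (size w).+1).
  by apply/hasP; exists (size w); [rewrite mem_iota ltnSn|exact: is_period_size].
have := nth_find 0 has_p; rewrite nth_iota //.
by move: has_p; rewrite has_find size_iota.
Qed.

Lemma min_period_le (T : eqType) (w : seq T) p : is_period w p -> min_period w <= p.
Proof.
move=> wp; rewrite leqNgt; apply/negP => lt.
have p_le : p <= size w by case/andP: wp => /andP[].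
have := before_find 0 lt; rewrite nth_iota ?add0n ?wp //.
Qed.

Import Order.TTheory GRing.Theory Num.Theory.
Local Open Scope ring_scope.

Lemma critical_exponent_le (R : realType) (T : eqType) (x : nat -> T) (c d : nat) :
  (0 < d)%N ->
  (forall i p l, (0 < p)%N -> (c * p < d * (l + p))%N -> ~ repetition x i p l) ->
  (critical_exponent R x <= (c%:R / d%:R)%:E)%E.
Proof.
move=> d_gt0 free; apply: ge_ereal_sup => _ [w [[i wE] w0] <-].
have w_gt0 : (0 < size w)%N by case: (w) w0.
have := min_periodP w_gt0; rewrite {1}wE -/(window x i (size w)).
move=> /is_periodP[/andP[p_gt0 pw] rep].
rewrite lee_fin /word_exp ler_pdivrMr ?ltr0n // mulrAC ler_pdivlMr ?ltr0n //.
rewrite -!natrM ler_nat leqNgt; apply/negP => lt.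
by apply: (free i _ _ p_gt0 _ rep); rewrite subnK // [(d * _)%N]mulnC.
Qed.

(** The minimal period may be smaller than [p], which only raises the exponent of the word. *)
Lemma critical_exponent_ge (R : realType) (T : eqType) (x : nat -> T) (c d i p l : nat) :
  (0 < p)%N -> (0 < d)%N -> (c * p <= d * (l + p))%N -> repetition x i p l ->
  ((c%:R / d%:R)%:E <= critical_exponent R x)%E.
Proof.
move=> p_gt0 d_gt0 le rep; set w := window x i (l + p).
have wp : is_period w p by apply/is_periodP; rewrite addnK leq_addl p_gt0.
have w_gt0 : (0 < size w)%N by rewrite size_mkseq; lia.
apply: (@le_trans _ _ (word_exp R w)%:E); last first.
  apply: ereal_sup_ubound; exists w => //; split; first by exists i; rewrite size_mkseq.
  by move=> w0; rewrite w0 in w_gt0.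
have /is_periodP[/andP[mp_gt0 _] _] := min_periodP w_gt0.
rewrite lee_fin /word_exp ler_pdivrMr ?ltr0n // mulrAC ler_pdivlMr ?ltr0n //.
rewrite -!natrM ler_nat size_mkseq mulnC.
apply: leq_trans (leq_trans le _); last by rewrite mulnC.
by rewrite mulnC leq_mul2l min_period_le // orbT.
Qed.

Theorem theorem11 (R : realType) :
  repetition_threshold R binary_fib_automatic = ((7 / 3 : R)%:E)%E.
Proof.
apply/eqP; rewrite eq_le; apply/andP; split.
  apply: ge_ereal_inf; exists (critical_exponent R xi).
    by exists xi => //; exact: xi_fib_automatic.
  apply: (@critical_exponent_le R _ xi 7 3) => // i p l p_gt0 lt.
  by apply: xi_free => //; lia.
apply: le_ereal_inf_tmp => _ [x xA <-].
rewrite leNgt; apply/negP => lt.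
(* A repetition with [4 * p <= 3 * l] has exponent at least 7/3, so a smaller critical exponent
   makes [x] a word of low exponent. *)
apply: (fib_automatic_not_low xA) => i p l p_gt0 pl rep.
move: lt; rewrite ltNge => /negP; apply.
by apply: (critical_exponent_ge R p_gt0 (isT : (0 < 3)%N) _ rep); lia.
Qed.
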